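(* Let $k\ge 1$. The map $\sigma_k$ is $k^2$-to-$1$ from $\Omega_k$ to $\Omega$, i.e. every point of $\Omega$ has exactly $k^2$ preimages under $\sigma_k$ in $\Omega_k$.
   Context: Points of $\mathbb{C}^4$ are written $z=(z_0,\underline{z})$ with $\underline{z}=(z_1,z_2,z_3)$, and $\underline{z}^2:=z_1^2+z_2^2+z_3^2\in\mathbb{C}$. For an integer $k\ge1$, $p_0^k$ and $p_1^{k-1}$ are the two-variable integer polynomials determined by $(x+\imath y)^k=p_0^k(x,y^2)+\imath\, y\,p_1^{k-1}(x,y^2)$ for $x,y\in\mathbb{R}$. The map $\sigma_k:\mathbb{C}^4\to\mathbb{C}^4$ is $$\sigma_k(z_0,\underline{z})=\big(p_0^k(z_0,\underline{z}^2),\ p_1^{k-1}(z_0,\underline{z}^2)\,\underline{z}\big)$$ (it is the $k$-th power map of the algebra $\mathbb{C}\otimes_{\mathbb{R}}\mathbb{H}\cong\mathbb{C}^4$, with basis $1\otimes1,1\otimes i,1\otimes j,1\otimes k$). Put $$\Omega=\{(z_0,\underline{z})\in\mathbb{C}^4:\ \underline{z}^2\ne0,\ z_0^2+\underline{z}^2\neq0,\ z_0\neq0\},\qquad \Omega_k=\{(z_0,\underline{z})\in\Omega:\ p_1^{k-1}(z_0,\underline{z}^2)\neq0\}.$$ *)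

(* Defs.v *)
From HB Require Import structures.
From mathcomp Require Import all_boot all_order all_algebra.
From mathcomp Require Import classical_sets functions cardinality reals.
From mathcomp Require Export complex.

Set Implicit Arguments.
Unset Strict Implicit.
Unset Printing Implicit Defensive.

Import Order.TTheory GRing.Theory Num.Theory.

Local Open Scope ring_scope.
Local Open Scope complex_scope.
Local Open Scope classical_set_scope.

(* {poly {poly int}} represents Z[X, Y]: the outer variable is X, the inner
   one is Y, and integer coefficients are evaluated through intr. *)
Definition eval2 (S : comNzRingType) (p : {poly {poly int}}) (x y : S) : S :=
  (map_poly (map_poly intr) p).[x%:P].[y].

Definition is_power_polys (R : realType) (k : nat) (p0 p1 : {poly {poly int}})
    : Prop :=
  forall x y : R,
    (x +i* y) ^+ k = eval2 p0 x (y ^+ 2) +i* (y * eval2 p1 x (y ^+ 2)).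

Lemma eval2D (S : comNzRingType) (p q : {poly {poly int}}) (x y : S) :
  eval2 (p + q) x y = eval2 p x y + eval2 q x y.
Proof. by rewrite /eval2 rmorphD /= !hornerD. Qed.

Lemma eval2B (S : comNzRingType) (p q : {poly {poly int}}) (x y : S) :
  eval2 (p - q) x y = eval2 p x y - eval2 q x y.
Proof. by rewrite /eval2 rmorphB /= !hornerD !hornerN. Qed.

Lemma eval2M (S : comNzRingType) (p q : {poly {poly int}}) (x y : S) :
  eval2 (p * q) x y = eval2 p x y * eval2 q x y.
Proof. by rewrite /eval2 rmorphM /= !hornerM. Qed.

Lemma eval2_0 (S : comNzRingType) (x y : S) : eval2 0 x y = 0.
Proof. by rewrite /eval2 rmorph0 !horner0. Qed.

Lemma eval2_1 (S : comNzRingType) (x y : S) : eval2 1 x y = 1.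
Proof. by rewrite /eval2 rmorph1 !hornerC. Qed.

Lemma eval2X (S : comNzRingType) (x y : S) : eval2 'X x y = x.
Proof. by rewrite /eval2 map_polyX hornerX hornerC. Qed.

Lemma eval2Y (S : comNzRingType) (x y : S) : eval2 'X%:P x y = y.
Proof. by rewrite /eval2 map_polyC /= map_polyX hornerC hornerX. Qed.

Lemma power_polys_exist (k : nat) :
  exists p : {poly {poly int}} * {poly {poly int}},
    forall R : realType, is_power_polys R k p.1 p.2.
Proof.
elim: k => [|k [[p0 p1] /= IH]].
  by exists (1, 0) => R x y; rewrite expr0 eval2_0 eval2_1 mulr0.
exists ('X * p0 - 'X%:P * p1, p0 + 'X * p1) => R x y.
rewrite exprS IH eval2B eval2D !eval2M eval2X eval2Y; apply/eqP; rewrite eq_complex /=.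
apply/andP; split; apply/eqP; first by rewrite mulrA expr2.
by rewrite mulrDr [y * (x * _)]mulrCA addrC.
Qed.

Lemma poly_inj_roots (S : idomainType) (f : nat -> S) (p : {poly S}) :
  injective f -> (forall n, p.[f n] = 0) -> p = 0.
Proof.
move=> finj fp; apply/eqP/negPn/negP => p0.
have := max_poly_roots p0 (rs := map f (iota 0 (size p))).
rewrite size_map size_iota ltnn map_inj_uniq // iota_uniq => H.
suff /H/(_ isT) : all (root p) (map f (iota 0 (size p))) by [].
by apply/allP => _ /mapP[n _ ->]; apply/rootP.
Qed.

Lemma eval2_inj (R : realType) (p q : {poly {poly int}}) :
  (forall x y : R, y != 0 -> eval2 p x (y ^+ 2) = eval2 q x (y ^+ 2)) -> p = q.
Proof.
move=> pq; apply: (map_inj_poly (f := map_poly (intr : int -> R))).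
- by apply: map_inj_poly => //; apply: intr_inj.
- by rewrite map_poly0.
apply/eqP; rewrite -subr_eq0; apply/eqP.
apply: (@poly_inj_roots _ (fun n => n%:R%:P)).
  by move=> m n /polyC_inj /eqP; rewrite eqr_nat => /eqP.
move=> m; apply: (@poly_inj_roots _ (fun n => (n.+1%:R) ^+ 2)).
  move=> a b /eqP; rewrite eqrXn2 ?ler0n // eqr_nat eqSS => /eqP //.
move=> n; rewrite !hornerE; apply/eqP; rewrite subr_eq0; apply/eqP.
by apply: pq; rewrite pnatr_eq0.
Qed.

Lemma power_polys_unique (R : realType) (k : nat)
    (p0 p1 q0 q1 : {poly {poly int}}) :
  is_power_polys R k p0 p1 -> is_power_polys R k q0 q1 -> p0 = q0 /\ p1 = q1.
Proof.
move=> hp hq; split; apply: (@eval2_inj R) => x y y0.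
  by have := hp x y; rewrite hq => -[].
by have := hp x y; rewrite hq => -[_ /(mulfI y0)].
Qed.

(* A point (z_0, z_1, z_2, z_3) of C^4 is a pair of z_0 and (z_1, z_2, z_3). *)
Definition C4 (R : realType) : Type := (R[i] * 'rV[R[i]]_3)%type.

(* Bilinear, not Hermitian. *)
Definition vsq (R : realType) (v : 'rV[R[i]]_3) : R[i] :=
  \sum_(i < 3) v 0 i ^+ 2.

Definition sigma (R : realType) (p0 p1 : {poly {poly int}}) (z : C4 R) : C4 R :=
  (eval2 p0 z.1 (vsq z.2), eval2 p1 z.1 (vsq z.2) *: z.2).

Definition Omega (R : realType) : set (C4 R) :=
  [set z | [/\ vsq z.2 != 0, z.1 ^+ 2 + vsq z.2 != 0 & z.1 != 0]].

Definition Omega_k (R : realType) (p1 : {poly {poly int}}) : set (C4 R) :=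
  [set z | Omega z /\ eval2 p1 z.1 (vsq z.2) != 0].

Arguments Omega R : clear implicits.
Arguments Omega_k R p1 : clear implicits.

(* Main.v *)
Require Import Defs.
From mathcomp Require Import all_boot all_order all_algebra.
From mathcomp Require Import classical_sets functions cardinality reals.
From mathcomp Require Import finmap separable ring.
Import Order.TTheory GRing.Theory Num.Theory.
Local Open Scope ring_scope.
Local Open Scope classical_set_scope.
Local Open Scope card_scope.

(** Every point of the fibre of [w] lies in the commutative subalgebra that [w]
    generates over [C], so the problem is one of taking [k]-th roots there.  Fix
    [w = (w0, v)] in [Omega] and a square root [s] of [vsq v], which is nonzero.
    If [sigma z = w], then [z.2] is a multiple of [v], say [z.2 = (t / s) v],
    so that [t ^+ 2 = vsq z.2].  The identity defining the two polynomials holds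
    in every commutative ring with a square root of [-1] (lemma
    [power_polys_ring]); applied to both [i] and [-i], it turns [sigma z = w]
    into the two decoupled equations
    [[ (z.1 + i t)^k = w0 + i s   and   (z.1 - i t)^k = w0 - i s. ]]
    In the coordinates [a = z.1 + i t], [b = z.1 - i t] the fibre is therefore
    a product of two sets of [k]-th roots (lemma [fiberP]).  The product of the
    two right-hand sides is [w0 ^+ 2 + vsq v], nonzero on [Omega], so each of
    them has exactly [k] distinct roots (lemma [nth_roots]).

    The remaining conditions on [w] ensure that all [k ^ 2] pairs give points
    of [Omega_k]: [s != 0] makes [t] and the value of [p1] nonzero, since their
    product is [s], and [z.1 = 0] would mean [a = - b], hence
    [w0 + i s = +- (w0 - i s)], against [s != 0] or [w0 != 0]. *)

(** The identity is given over the reals only, but it determines the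
    polynomials, so they are the ones produced by the recursion for powers,
    and for these the identity holds in any ring where [j ^+ 2 = -1]. *)
Lemma power_polys_ring {R : realType} {k : nat} {p0 p1 : {poly {poly int}}}
    (hp : is_power_polys R k p0 p1) {S : comNzRingType} (j x y : S) :
  j ^+ 2 = -1 ->
  (x + j * y) ^+ k = eval2 p0 x (y ^+ 2) + j * (y * eval2 p1 x (y ^+ 2)).
Proof.
have [q0 [q1 [hq hqS]]] : exists q0 q1 : {poly {poly int}},
    is_power_polys R k q0 q1 /\
    forall x y : S, j ^+ 2 = -1 ->
      (x + j * y) ^+ k = eval2 q0 x (y ^+ 2) + j * (y * eval2 q1 x (y ^+ 2)).
  elim: k {p0 p1 hp x y} => [|k [p0 [p1 [IHR IHS]]]].
    exists 1, 0; split=> x y *; first by rewrite expr0 eval2_0 eval2_1 mulr0.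
    by rewrite expr0 eval2_0 eval2_1 !mulr0 addr0.
  exists ('X * p0 - 'X%:P * p1), (p0 + 'X * p1); split=> x y.
    rewrite exprS IHR eval2B eval2D !eval2M eval2X eval2Y.
    by congr complex.Complex => /=; ring.
  move=> j2; rewrite exprS IHS // eval2B eval2D !eval2M eval2X eval2Y.
  have -> : y ^+ 2 * eval2 p1 x (y ^+ 2)
          = - (j ^+ 2 * (y ^+ 2 * eval2 p1 x (y ^+ 2))).
    by rewrite j2 mulN1r opprK.
  by ring.
have [-> ->] := @power_polys_unique R k p0 p1 q0 q1 hp hq.
exact: hqS.
Qed.

Lemma nth_roots (F : numClosedFieldType) (k : nat) (a : F) :
  (0 < k)%N -> a != 0 ->
  exists s : seq F,
    [/\ uniq s, size s = k & forall x, (x \in s) = (x ^+ k == a)].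
Proof.
move=> k_gt0 a0; pose p : {poly F} := 'X^k - a%:P.
have [s ps] := closed_field_poly_normal p.
have pE : p = \prod_(z <- s) ('X - z%:P).
  by rewrite {1}ps lead_coefXnsubC // scale1r.
exists s; split.
- (* [k a = X p' - k p] is a nonzero constant, so [p] is separable. *)
  rewrite -separable_prod_XsubC -pE unlock.
  apply/Bezout_eq1_coprimepP.
  exists (- (a^-1)%:P, (k%:R^-1 * a^-1)%:P * 'X) => /=.
  have aV : (a^-1)%:P * a%:P = 1 :> {poly F} by rewrite -polyCM mulVf.
  have kV : (k%:R^-1)%:P * k%:R = 1 :> {poly F}.
    by rewrite -polyC_natr -polyCM mulVf // pnatr_eq0 -lt0n.
  rewrite /p {p ps pE} derivB derivXn derivC subr0 polyCM.
  have -> : 'X^k = 'X * 'X^(k.-1) :> {poly F} by rewrite -exprS prednK.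
  transitivity (((k%:R^-1)%:P * k%:R) * (a^-1)%:P * 'X * 'X^(k.-1)
    - (a^-1)%:P * ('X * 'X^(k.-1)) + (a^-1)%:P * a%:P : {poly F}).
    by ring.
  by rewrite kV aV mul1r; ring.
- have /eqP := congr1 (fun q : {poly F} => size q) pE.
  by rewrite size_XnsubC // size_prod_XsubC eqSS => /eqP.
- move=> x; rewrite -root_prod_XsubC -pE /root /p !hornerE.
  by rewrite subr_eq0.
Qed.

Lemma card_eq_seq (T : choiceType) (s : seq T) :
  uniq s -> [set` s] #= `I_(size s).
Proof.
move=> us; have sE : [set` seq_fset tt s] = [set` s].
  by apply/seteqP; split=> x; rewrite /mkset seq_fsetE.
suff : [set` seq_fset tt s] #= `I_(size s) by rewrite sE.
by apply: (introT card_eq_fsetP); rewrite size_seq_fset undup_id.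
Qed.

Lemma vsqZ (R : realType) (c : R[i]%C) (v : 'rV_3) :
  vsq (c *: v) = c ^+ 2 * vsq v.
Proof. by rewrite /vsq mulr_sumr; apply: eq_bigr => i _; rewrite mxE exprMn. Qed.

(** The inverse of [z |-> (z.1 + i t, z.1 - i t)], where [z.2 = (t / s) v]. *)
Definition fiber_point {R : realType} (s : R[i]%C) (v : 'rV[R[i]%C]_3)
    (ab : R[i]%C * R[i]%C) : C4 R :=
  ((ab.1 + ab.2) / 2, ((ab.1 - ab.2) / (2 * 'i) / s) *: v).

Lemma fiber_point_inj (R : realType) (s : R[i]%C) (v : 'rV[R[i]%C]_3) :
  s != 0 -> v != 0 -> injective (fiber_point s v).
Proof.
move=> s0 v0 [a b] [a' b'] [].
have two0 : 2 != 0 :> R[i]%C by rewrite pnatr_eq0.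
move=> /(mulIf (invr_neq0 two0)) hD /eqP.
rewrite -subr_eq0 -scalerBl scaler_eq0 (negPf v0) orbF subr_eq0 => /eqP.
move=> /(mulIf (invr_neq0 s0)).
have i0 : 2 * 'i != 0 :> R[i]%C by rewrite mulf_neq0 // neq0Ci.
move=> /(mulIf (invr_neq0 i0)) hB.
have ha : a = a'.
  by apply: (mulfI two0); transitivity ((a + b) + (a - b));
    [ring | rewrite hD hB; ring].
by move: hD; rewrite ha => /addrI ->.
Qed.

(** The values of [p0] and [p1] enter only through their two combinations
    [P0 +- i t P1], the [k]-th powers of [a] and [b]; adding and subtracting
    recovers [P0 = w.1] and [t * P1 = s], which is the equation [sigma z = w].
    The hypothesis that [w] lies in [Omega] is what places every such [z] in
    [Omega_k]. *)
Lemma fiberP {R : realType} {k : nat} {p0 p1 : {poly {poly int}}}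
    {w : C4 R} {s : R[i]%C} (z : C4 R) :
  (0 < k)%N -> is_power_polys R k p0 p1 -> Omega R w -> s ^+ 2 = vsq w.2 ->
  (Omega_k R p1 z /\ sigma p0 p1 z = w) <->
  exists a b, [/\ a ^+ k = w.1 + 'i * s, b ^+ k = w.1 - 'i * s
                & z = fiber_point s w.2 (a, b)].
Proof.
case: w => w0 v k_gt0 hp [/= vv0 hw w00] sv.
have i2 : 'i ^+ 2 = -1 :> R[i]%C by rewrite sqrCi.
have i2' : (- 'i) ^+ 2 = -1 :> R[i]%C by rewrite sqrrN.
have i0 : 'i != 0 :> R[i]%C by rewrite neq0Ci.
have two0 : 2 != 0 :> R[i]%C by rewrite pnatr_eq0.
have s0 : s != 0 by rewrite -sqrf_eq0 sv.
split.
  case: z => z0 u [[_ /= p10] []].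
  set c := eval2 p1 z0 (vsq u) in p10 *.
  move=> e0 eu.
  (* [u = c^-1 v], so this is the square root of [vsq u] matching [s]. *)
  pose t := c^-1 * s.
  have uE : u = c^-1 *: v by rewrite -eu scalerA mulVf // scale1r.
  have tt : vsq u = t ^+ 2 by rewrite {1}uE vsqZ -sv exprMn.
  have tc : t * c = s by rewrite /t mulrAC mulVf // mul1r.
  exists (z0 + 'i * t), (z0 + - 'i * t); split.
  - by rewrite (power_polys_ring hp) // -tt e0 -/c tc.
  - by rewrite (power_polys_ring hp) // -tt e0 -/c tc mulNr.
  - rewrite /fiber_point /=; congr pair; first by field.
    rewrite uE; congr (_ *: _); rewrite /t.
    by field; rewrite p10 s0 i0.
case=> a [b [aA bB ->]]; rewrite /fiber_point /=.
set x := (a + b) / 2; set t := (a - b) / (2 * 'i).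
have aE : a = x + 'i * t by rewrite /x /t; field.
have bE : b = x + - 'i * t by rewrite /x /t; field.
have tt : vsq ((t / s) *: v) = t ^+ 2 by rewrite vsqZ -sv -exprMn divfK.
move: (aA) (bB); rewrite {1}aE {1}bE !(power_polys_ring hp) //.
set P0 := eval2 p0 _ _; set P1 := eval2 p1 _ _ => aA' bB'.
have P0E : P0 = w0.
  apply: (mulfI two0).
  transitivity ((P0 + 'i * (t * P1)) + (P0 + - 'i * (t * P1))); first by ring.
  by rewrite aA' bB'; ring.
have P1E : t * P1 = s.
  by apply: (mulfI i0); apply: (addrI P0); rewrite aA' P0E.
have /norP[t0 P10] : ~~ ((t == 0) || (P1 == 0)) by rewrite -mulf_eq0 P1E.
have ab : (w0 + 'i * s) * (w0 - 'i * s) = w0 ^+ 2 + vsq v.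
  by transitivity (w0 ^+ 2 - 'i ^+ 2 * s ^+ 2); [ring | rewrite i2 sv; ring].
split; last first.
  rewrite /sigma /= tt -/P0 -/P1 P0E scalerA mulrA [P1 * t]mulrC P1E.
  by rewrite divff // scale1r.
split; last by rewrite /= tt.
split; rewrite /= ?tt ?expf_neq0 //.
- (* [x ^+ 2 + t ^+ 2 = a * b], whose [k]-th power is nonzero. *)
  have -> : x ^+ 2 + t ^+ 2 = a * b.
    transitivity (x ^+ 2 - 'i ^+ 2 * t ^+ 2); first by rewrite i2; ring.
    by rewrite aE bE; ring.
  have : (a * b) ^+ k != 0 by rewrite exprMn aA bB ab.
  by rewrite expf_eq0 k_gt0.
- (* If [x = 0] then [a = - b], so the two [k]-th powers agree up to sign. *)
  apply/eqP => x0.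
  have abN : a = (-1) * b by rewrite aE bE x0; ring.
  move: aA; rewrite abN exprMn bB -signr_odd.
  case: (odd k); rewrite ?expr1 ?expr0 => e.
    move/eqP: w00; apply; apply: (mulfI two0).
    transitivity ((w0 + 'i * s) + (w0 - 'i * s)); first by ring.
    by rewrite -e; ring.
  move/eqP: s0; apply; apply: (mulfI (mulf_neq0 two0 i0)).
  transitivity ((w0 + 'i * s) - (w0 - 'i * s)); first by ring.
  by rewrite -e; ring.
Qed.

Theorem proposition4p3 (R : realType) (k : nat) (hk : (1 <= k)%N)
    (p0 p1 : {poly {poly int}}) (hp : is_power_polys R k p0 p1)
    (w : C4 R) (hw : Omega R w) :
  [set z : C4 R | Omega_k R p1 z /\ sigma p0 p1 z = w] #= `I_(k ^ 2).
Proof.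
have [vv0 ww0 _] := hw; set v := w.2 in vv0 ww0 *.
pose s := sqrtC (vsq v).
have sv : s ^+ 2 = vsq v by rewrite sqrtCK.
have s0 : s != 0 by rewrite -sqrf_eq0 sv.
have v0 : v != 0.
  apply: contra_neq vv0 => ->.
  by rewrite /vsq big1 // => i _; rewrite mxE expr0n.
have : (w.1 + 'i * s) * (w.1 - 'i * s) != 0.
  suff -> : (w.1 + 'i * s) * (w.1 - 'i * s) = w.1 ^+ 2 + vsq v by [].
  transitivity (w.1 ^+ 2 - 'i ^+ 2 * s ^+ 2); first by ring.
  by rewrite sqrCi sv; ring.
rewrite mulf_eq0 => /norP[A0 B0].
have [ra [ura sza raP]] := @nth_roots _ k _ hk A0.
have [rb [urb szb rbP]] := @nth_roots _ k _ hk B0.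
pose L := [seq fiber_point s v ab | ab <- [seq (a, b) | a <- ra, b <- rb]].
have -> : [set z | Omega_k R p1 z /\ sigma p0 p1 z = w] = [set` L].
  apply/seteqP; split=> z /=.
    move=> /(fiberP z hk hp hw sv)[a [b [aA bB ->]]].
    apply: map_f; apply/allpairsP; exists (a, b); split=> //=.
      by rewrite raP aA.
    by rewrite rbP bB.
  move=> /mapP[_ /allpairsP[[a b] [/= aA bB ->]] ->].
  apply/(fiberP _ hk hp hw sv); exists a, b.
  by split=> //; apply/eqP; rewrite -?raP -?rbP.
have -> : (k ^ 2 = size L)%N.
  by rewrite size_map size_allpairs sza szb mulnn.
apply: card_eq_seq; rewrite map_inj_uniq; last exact: fiber_point_inj.
by apply: allpairs_uniq => // [[? ?] [? ?]] /=.
Qed.
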